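(* Let $f\in\mathcal{C}_1$. Then $$\mathcal{J}[f] = \left( \int_0^\infty f^2(x)\, \mathrm{d}x \right)^{1/2} \left( \int_0^\infty x^2 f^2(x)\, \mathrm{d}x \right)^{1/2} \ge \frac{1}{\pi} + \frac{1}{\pi}\, d^2(f,\mathcal{E}),$$ where $$d^2(f,\mathcal{E}) := \inf_{z>0} \int_0^\infty \frac{(f-\varphi_{z})^2(x)}{\varphi_{z}(x)}\, \mathrm{d}x .$$ Moreover, the constant $1/\pi$ in front of $d^2(f,\mathcal{E})$ is optimal. In fact, setting $$\varrho(f) := \frac{1}{d^2(f,\mathcal{E})} \left[ \mathcal{J}[f] - \frac{1}{\pi} \right], \qquad f\in\mathcal{C}_1\setminus\mathcal{E},$$ we have $$\inf_{f\in\mathcal{C}_1\setminus\mathcal{E}} \varrho(f) = \min_{f\in\mathcal{C}_1\setminus\mathcal{E}} \varrho(f) = \frac{1}{\pi} = \varrho(\psi_z) \quad\text{for every } z\in (0,\infty),$$ where $$\psi_z(x) := \frac{4}{\pi} \frac{z}{(1+z^2 x^2)^2}, \qquad (x,z)\in (0,\infty)^2 .$$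
   Context: Functions are real-valued on $(0,\infty)$ and identified when they agree almost everywhere. Let $$\mathcal{C}_1 := \left\{ f\in L^2((0,\infty),(1+x^2)\, \mathrm{d}x)\ : \ f\ge 0 \text{ a.e. and } \|f\|_{L^1((0,\infty))}=1 \right\}.$$ For $z>0$ define $$\varphi_z(x) := \frac{2}{\pi} \frac{z}{1+z^2 x^2}, \qquad x\in (0,\infty),$$ and let $\mathcal{E} := \{\varphi_z : z>0\}$. For $f\in\mathcal{C}_1$, $$\mathcal{J}[f] := \left( \int_0^\infty f^2(x)\, \mathrm{d}x \right)^{1/2} \left( \int_0^\infty x^2 f^2(x)\, \mathrm{d}x \right)^{1/2}.$$ *)

(* Defs.v *)
From HB Require Import structures.
From mathcomp Require Import all_boot all_order all_algebra.
From mathcomp Require Import all_classical all_reals all_analysis.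

Set Implicit Arguments.
Unset Strict Implicit.
Unset Printing Implicit Defensive.

Import Order.TTheory GRing.Theory Num.Theory.
Import numFieldNormedType.Exports.

Local Open Scope classical_set_scope.
Local Open Scope ring_scope.

(* Functions on (0, +oo) are represented by total functions R -> R whose
   values outside (0, +oo) are irrelevant: every notion below depends only on
   the restriction to (0, +oo), and, for measurable functions, only on its
   class modulo almost everywhere equality. Every Lebesgue measurable function
   has a representative that is measurable in the (Borel) sense of
   [measurable_fun]. *)
Section definitions.
Context {R : realType}.
Implicit Types (f : R -> R) (x z : R).

Definition mu : {measure set (measurableTypeR R) -> \bar R} :=
  @lebesgue_measure R.

Definition posline : set R := `]0, +oo[.

(* f \in L^2((0, +oo), (1 + x^2) dx), f >= 0 a.e., and ||f||_{L^1} = 1 *)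
Definition calC1 : set (R -> R) := [set f : R -> R |
  [/\ measurable_fun posline f,
      (\int[mu]_(x in posline) (`|f x| ^+ 2 * (1 + x ^+ 2))%:E < +oo)%E,
      {ae mu, forall x, posline x -> 0 <= f x}
    & (\int[mu]_(x in posline) `|f x|%:E = 1)%E]].

Definition phi z x : R := 2 / pi * (z / (1 + z ^+ 2 * x ^+ 2)).

Definition psi z x : R := 4 / pi * (z / (1 + z ^+ 2 * x ^+ 2) ^+ 2).

Definition calE : set (R -> R) :=
  [set f : R -> R | exists2 z, 0 < z & ae_eq mu posline f (phi z)].

Definition calJ f : \bar R :=
  ((\int[mu]_(x in posline) (f x ^+ 2)%:E) `^ 2^-1 *
   (\int[mu]_(x in posline) (x ^+ 2 * f x ^+ 2)%:E) `^ 2^-1)%E.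

(* the squared distance d^2(f, E), not the distance *)
Definition dist2 f : \bar R :=
  ereal_inf [set (\int[mu]_(x in posline)
                    ((f x - phi z x) ^+ 2 / phi z x)%:E)%E | z in [set z | 0 < z]].

(* Division in \bar R, where 0^-1 = +oo and +oo^-1 = 0; it is the division of
   the reals when dist2 f is finite and nonzero. *)
Definition rho f : \bar R := ((dist2 f)^-1 * (calJ f - pi^-1%:E))%E.

End definitions.

(* Main.v *)
(* Since [1 / phi z x = pi / 2 * (1 / z + z x^2)] and [f], [phi z] both have
   integral 1, expanding the square shows that the weighted distance of [f] to
   [phi z] is [pi / 2 * (A / z + z B) - 1], where [A] and [B] are the integrals
   of [f^2] and [x^2 f^2]. Its minimum over [z], reached at [z = sqrt (A / B)],
   is [pi * sqrt (A B) - 1 = pi * J[f] - 1]. The inequality is thus an equality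
   for every [f], and [rho] is constant; the minimum over [z] being reached, the
   distance vanishes only on [E]. *)
Require Import Defs.
From mathcomp Require Import all_boot all_order all_algebra.
From mathcomp Require Import all_classical all_reals all_analysis.
From mathcomp Require Import measurable_realfun ring lra.

Set Implicit Arguments.
Unset Strict Implicit.
Unset Printing Implicit Defensive.

Import Order.TTheory GRing.Theory Num.Theory.
Import numFieldNormedType.Exports.

Local Open Scope classical_set_scope.
Local Open Scope ring_scope.

Section stability.
Context {R : realType}.
Implicit Types (f F : R -> R) (x z : R).

Local Notation mu := (@mu R).
Local Notation posline := (@posline R).

Lemma measurable_posline : measurable (posline : set (measurableTypeR R)).
Proof. exact: measurable_itv. Qed.
Hint Resolve measurable_posline : core.

Lemma posline_gt0 x : posline x -> 0 < x.
Proof. by rewrite /Defs.posline /= in_itv /= andbT. Qed.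

(** * Positivity, continuity and measurability of [phi z] and [psi z] *)

Lemma onez2x2_gt0 z x : 0 < 1 + z ^+ 2 * x ^+ 2.
Proof. by rewrite ltr_pwDl// mulr_ge0// sqr_ge0. Qed.

Lemma phi_gt0 z x : 0 < z -> 0 < phi z x.
Proof.
by move=> z0; rewrite /phi mulr_gt0// divr_gt0// ?pi_gt0// onez2x2_gt0.
Qed.

Lemma psi_gt0 z x : 0 < z -> 0 < psi z x.
Proof.
move=> z0; rewrite /psi mulr_gt0// divr_gt0// ?pi_gt0//.
by rewrite exprn_gt0// onez2x2_gt0.
Qed.

Lemma continuous_onez2x2V z : continuous (fun x => (1 + z ^+ 2 * x ^+ 2)^-1).
Proof.
move=> x; apply: cvgV; first by rewrite gt_eqF// onez2x2_gt0.
apply: cvgD; first exact: cvg_cst.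
by apply: cvgM; [exact: cvg_cst|exact: exprn_continuous].
Qed.

Lemma continuous_phi z : continuous (phi z).
Proof.
move=> x; do 2 (apply: cvgM; first exact: cvg_cst).
exact: continuous_onez2x2V.
Qed.

Lemma psiE z x : psi z x = 2 * phi z x / (1 + z ^+ 2 * x ^+ 2).
Proof.
have := lt0r_neq0 (pi_gt0 R); have := lt0r_neq0 (onez2x2_gt0 z x).
by rewrite /psi /phi; move: pi (1 + _) => p u u0 p0; field; rewrite u0.
Qed.

Lemma continuous_psi z : continuous (psi z).
Proof.
rewrite (_ : psi z = fun x => 2 * phi z x / (1 + z ^+ 2 * x ^+ 2)); last first.
  by apply/funext => x; exact: psiE.
move=> x; apply: cvgM; last exact: continuous_onez2x2V.
by apply: cvgM; [exact: cvg_cst|exact: continuous_phi].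
Qed.

Lemma measurable_continuous f : continuous f -> measurable_fun posline f.
Proof.
by move=> cf; apply: measurable_funTS; exact: continuous_measurable_fun.
Qed.

Lemma measurable_phi z : measurable_fun posline (phi z).
Proof. by apply: measurable_continuous; exact: continuous_phi. Qed.

Lemma measurable_phiV z : 0 < z ->
  measurable_fun posline (fun x => (phi z x)^-1).
Proof.
move=> z0; apply: measurable_continuous => x.
by apply: cvgV; [rewrite gt_eqF// phi_gt0|exact: continuous_phi].
Qed.

Lemma measurable_psi z : measurable_fun posline (psi z).
Proof. by apply: measurable_continuous; exact: continuous_psi. Qed.

(** * Total masses of the two profiles *)

(** Nonnegativity of [f] lets the antiderivative compute the Lebesgue integral without prior
    integrability. The missing endpoint 0 is a null set, and [F] is continuous there because it is
    differentiable on all of [R]. *)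
Lemma integral_posline_FTC f F (l : R) : continuous f -> (forall x, 0 <= f x) ->
  (forall x, is_derive x 1 F (f x)) -> F x @[x --> +oo] --> l ->
  (\int[mu]_(x in posline) (f x)%:E = (l - F 0)%:E)%E.
Proof.
move=> cf f0 dF Fl; rewrite /Defs.mu /Defs.posline.
rewrite integral_itv_obnd_cbnd; last first.
  by apply/measurable_EFinP; exact: measurable_continuous.
rewrite (@ge0_continuous_FTC2y _ f F 0 l)//.
- exact: continuous_subspaceT.
- apply: cvg_at_right_filter.
  by apply/differentiable_continuous/derivable1_diffP; have [] := dF 0.
- by move=> x _; rewrite derive1E; have [_ ->] := dF x.
Qed.

Lemma is_derive_atanZ z x :
  is_derive x 1 (fun x => atan (z * x)) (z / (1 + z ^+ 2 * x ^+ 2)).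
Proof.
rewrite [z / _]mulrC -exprMn.
apply: (@is_derive1_comp _ _ (fun x => z * x)).
by apply: is_derive_eq; rewrite /GRing.scale /= mulr1.
Qed.

Lemma cvgy_atanZ z : 0 < z -> atan (z * x) @[x --> +oo] --> pi / 2.
Proof.
move=> z0; apply: (@cvg_comp _ _ _ (fun x => z * x)); last exact: cvgy_atan.
by apply: gt0_cvgMry => //; exact: cvg_id.
Qed.

Lemma integral_phi z : 0 < z -> (\int[mu]_(x in posline) (phi z x)%:E = 1)%E.
Proof.
move=> z0; pose F x := 2 / pi * atan (z * x).
have dF x : is_derive x 1 F (phi z x).
  have dA := is_derive_atanZ z x.
  by apply: is_derive_eq; rewrite /GRing.scale/= /phi; ring.
have Fl : F x @[x --> +oo] --> (1 : R).
  rewrite [X in _ --> X](_ : _ = 2 / pi * (pi / 2)); last first.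
    by move: (lt0r_neq0 (pi_gt0 R)); move: pi => p p0; field.
  by apply: cvgM; [exact: cvg_cst|exact: cvgy_atanZ].
rewrite (integral_posline_FTC (@continuous_phi z) _ dF Fl) => [|x].
  by rewrite /F mulr0 atan0 mulr0 subr0.
by rewrite ltW// phi_gt0.
Qed.

(* With [a = atan (z x)], [cos a ^ 2 = 1 / (1 + z^2 x^2)], so that
   [a + sin a cos a] has derivative [2 a' cos a ^ 2]. *)
Lemma integral_psi z : 0 < z -> (\int[mu]_(x in posline) (psi z x)%:E = 1)%E.
Proof.
move=> z0; pose G (a : R) := 2 / pi * (a + sin a * cos a).
have dG (a : R) : is_derive a (1 : R) G (2 / pi * (2 * cos a ^+ 2)).
  apply: is_derive_eq; rewrite /GRing.scale/=.
  have := cos2Dsin2 a; move: (sin a) (cos a) => s c sc.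
  by congr (_ * _); lra.
have dF x : is_derive x 1 (G \o (fun x => atan (z * x))) (psi z x).
  apply: (is_derive_eq (is_derive1_comp (dG _) (is_derive_atanZ z x))).
  rewrite cos_atan exprVn sqr_sqrtr ?exprMn; last exact/ltW/onez2x2_gt0.
  rewrite psiE /phi; have := lt0r_neq0 (onez2x2_gt0 z x).
  by move: pi^-1 (1 + _) => p u u0; field; rewrite u0.
have Fl : (G \o (fun x => atan (z * x))) x @[x --> +oo] --> (1 : R).
  rewrite [X in _ --> X](_ : _ = G (pi / 2)); last first.
    rewrite /G cos_pihalf mulr0 addr0.
    by move: (lt0r_neq0 (pi_gt0 R)); move: pi => p p0; field.
  apply: (@cvg_comp _ _ _ (fun x => atan (z * x))); first exact: cvgy_atanZ.
  apply: differentiable_continuous; apply/derivable1_diffP.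
  by have [] := dG (pi / 2).
rewrite (integral_posline_FTC (@continuous_psi z) _ dF Fl) => [|x].
  by rewrite /G /= mulr0 atan0 sin0 mul0r addr0 mulr0 subr0.
by rewrite ltW// psi_gt0.
Qed.

(** * Weighted integrals of squares and the moments of [f] *)

Lemma measurable_sqr f : measurable_fun posline f ->
  measurable_fun posline (fun x => f x ^+ 2).
Proof. by move=> mf; exact: measurable_funX. Qed.

Lemma measurable_sqr_EFin f : measurable_fun posline f ->
  measurable_fun posline (fun x => (f x ^+ 2)%:E).
Proof. by move=> mf; apply/measurable_EFinP; exact: measurable_sqr. Qed.

Lemma measurable_weighted_sqr (w h : R -> R) :
  measurable_fun posline w -> measurable_fun posline h ->
  measurable_fun posline (fun x => (w x * h x ^+ 2)%:E).
Proof.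
move=> mw mh; apply/measurable_EFinP/measurable_funM => //.
exact: measurable_sqr.
Qed.

(** Serves twice: with weight 1 or [x ^+ 2] and [h = f], for the positivity of the moments; with
    weight [(phi z x)^-1] and [h = f - phi z], for the case of zero distance. *)
Lemma ae_eq0_of_integral_sqr_eq0 (w h : R -> R) :
  measurable_fun posline w -> measurable_fun posline h ->
  (forall x, posline x -> 0 < w x) ->
  (\int[mu]_(x in posline) (w x * h x ^+ 2)%:E = 0)%E ->
  ae_eq mu posline h (cst 0).
Proof.
move=> mw mh w0 I0.
have [+ _] := ae_eq_integral_abs mu measurable_posline
  (measurable_weighted_sqr mw mh).
have -> : (\int[mu]_(x in posline) `|(w x * h x ^+ 2)%:E|)%E = 0%E.
  rewrite -I0; apply: eq_integral => x /set_mem xp.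
  by rewrite gee0_abs// lee_fin mulr_ge0 ?sqr_ge0// ltW// w0.
move=> /(_ erefl); apply: filterS => x /= + xp.
move=> /(_ xp) [] /eqP; rewrite mulf_eq0 gt_eqF ?w0//= sqrf_eq0.
by move=> /eqP.
Qed.

Lemma calC1_not_ae0 f : calC1 f -> ~ ae_eq mu posline f (cst 0).
Proof.
move=> [mf _ _ I1] f0.
have : (\int[mu]_(x in posline) `|f x|%:E = 0)%E.
  have mf' : measurable_fun posline (EFin \o f) by exact/measurable_EFinP.
  apply/(ae_eq_integral_abs mu measurable_posline mf').
  by apply: filterS f0 => x /= f0 xp; rewrite f0.
by rewrite I1 => -[] /eqP; rewrite oner_eq0.
Qed.

(** The weight [1 + x ^+ 2] splits the finite integral into the two moments, so both are finite. If
    one vanished, [f] would be null almost everywhere, against its mass 1. *)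
Lemma calC1_moments f : calC1 f -> exists A B : R, [/\ 0 < A, 0 < B,
  (\int[mu]_(x in posline) (f x ^+ 2)%:E = A%:E)%E &
  (\int[mu]_(x in posline) (x ^+ 2 * f x ^+ 2)%:E = B%:E)%E].
Proof.
move=> fC; have [mf fin _ _] := fC.
pose one : R -> R := cst 1.
have m1 : measurable_fun posline one by exact: measurable_cst.
have mx2 : measurable_fun posline (fun x : R => x ^+ 2).
  exact: exprn_measurable.
have E1 : (\int[mu]_(x in posline) (f x ^+ 2)%:E =
    \int[mu]_(x in posline) (one x * f x ^+ 2)%:E)%E.
  by apply: eq_integral => x _; rewrite mul1r.
have gt0 (w : R -> R) : measurable_fun posline w ->
    (forall x, posline x -> 0 < w x) ->
    (0 < \int[mu]_(x in posline) (w x * f x ^+ 2)%:E)%E.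
  move=> mw w0; rewrite lt0e; apply/andP; split; last first.
    apply: integral_ge0 => x xp.
    by rewrite lee_fin mulr_ge0 ?sqr_ge0// ltW// w0.
  by apply/eqP => /(ae_eq0_of_integral_sqr_eq0 mw mf w0)/(calC1_not_ae0 fC).
have A0 : (0 < \int[mu]_(x in posline) (f x ^+ 2)%:E)%E by rewrite E1 gt0.
have B0 : (0 < \int[mu]_(x in posline) (x ^+ 2 * f x ^+ 2)%:E)%E.
  by apply: gt0 => // x /posline_gt0 x0; rewrite exprn_gt0.
move: fin; rewrite (_ : (\int[mu]_(x in posline) _ =
    \int[mu]_(x in posline) (f x ^+ 2)%:E +
    \int[mu]_(x in posline) (x ^+ 2 * f x ^+ 2)%:E)%E); last first.
  rewrite -ge0_integralD//.
  - apply: eq_integral => x _; rewrite -EFinD; congr (_%:E).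
    by rewrite real_normK ?num_real//; ring.
  - by move=> x _; rewrite lee_fin sqr_ge0.
  - exact: measurable_sqr_EFin.
  - by move=> x _; rewrite lee_fin mulr_ge0// sqr_ge0.
  - exact: measurable_weighted_sqr.
(* Positivity excludes [-oo], and a sum below [+oo] then excludes [+oo]. *)
move: A0 B0; move: (\int[mu]_(x in posline) (f x ^+ 2)%:E)%E
  (\int[mu]_(x in posline) (x ^+ 2 * f x ^+ 2)%:E)%E.
move=> [A| |] [B| |]//; rewrite !lte_fin => A0 B0 _.
by exists A, B.
Qed.

(** * The weighted distance and its minimum over [z] *)

Lemma integral_dist f (A B : R) z : calC1 f ->
  (\int[mu]_(x in posline) (f x ^+ 2)%:E = A%:E)%E ->
  (\int[mu]_(x in posline) (x ^+ 2 * f x ^+ 2)%:E = B%:E)%E ->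
  0 < z ->
  (\int[mu]_(x in posline) ((f x - phi z x) ^+ 2 / phi z x)%:E =
   (pi / 2 * (A / z + z * B) - 1)%:E)%E.
Proof.
move=> fC IA IB z0; have [mf _ f0 I1] := fC.
have mphi := measurable_phi z; have mphiV := measurable_phiV z0.
have md : measurable_fun posline (fun x => ((f x - phi z x) ^+ 2 / phi z x)%:E).
  apply/measurable_EFinP/measurable_funM => //.
  by apply: measurable_sqr; exact: measurable_funB.
have mabs : measurable_fun posline (fun x => `|f x|%:E).
  by apply/measurable_EFinP; exact: measurableT_comp.
have mx2 : measurable_fun posline (fun x => (x ^+ 2 * f x ^+ 2)%:E).
  by apply: measurable_weighted_sqr => //; exact: exprn_measurable.
have m2 : measurable_fun posline (fun x => (f x ^+ 2)%:E).
  exact: measurable_sqr_EFin.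
have p0 : 0 < pi :> R := pi_gt0 R.
have a0 : 0 <= pi / 2 / z :> R by rewrite !divr_ge0// ltW.
have b0 : 0 <= pi / 2 * z :> R by rewrite mulr_ge0// ?divr_ge0// ltW.
have d0 x : (0 <= ((f x - phi z x) ^+ 2 / phi z x)%:E)%E.
  by rewrite lee_fin divr_ge0 ?sqr_ge0// ltW// phi_gt0.
have ma : measurable_fun posline (fun x => (pi / 2 / z)%:E * (f x ^+ 2)%:E)%E.
  exact: measurable_funeM.
have mb : measurable_fun posline
    (fun x => (pi / 2 * z)%:E * (x ^+ 2 * f x ^+ 2)%:E)%E.
  exact: measurable_funeM.
have mc : measurable_fun posline (fun x => 2%:E * `|f x|%:E)%E.
  exact: measurable_funeM.
have mp : measurable_fun posline (fun x => (phi z x)%:E).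
  exact/measurable_EFinP.
have a'0 x : posline x -> (0 <= (pi / 2 / z)%:E * (f x ^+ 2)%:E)%E.
  by move=> _; rewrite mule_ge0 ?lee_fin ?sqr_ge0.
have b'0 x : posline x -> (0 <= (pi / 2 * z)%:E * (x ^+ 2 * f x ^+ 2)%:E)%E.
  by move=> _; rewrite mule_ge0 ?lee_fin// mulr_ge0 ?sqr_ge0.
have c'0 x : posline x -> (0 <= 2%:E * `|f x|%:E)%E.
  by move=> _; rewrite mule_ge0 ?lee_fin.
have p'0 x : posline x -> (0 <= (phi z x)%:E)%E.
  by move=> _; rewrite lee_fin ltW// phi_gt0.
have ab0 x : posline x -> (0 <= (pi / 2 / z)%:E * (f x ^+ 2)%:E +
    (pi / 2 * z)%:E * (x ^+ 2 * f x ^+ 2)%:E)%E.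
  by move=> xp; rewrite adde_ge0 ?a'0 ?b'0.
have f20 x : posline x -> (0 <= (f x ^+ 2)%:E)%E.
  by move=> _; rewrite lee_fin sqr_ge0.
have x2f20 x : posline x -> (0 <= (x ^+ 2 * f x ^+ 2)%:E)%E.
  by move=> _; rewrite lee_fin mulr_ge0 ?sqr_ge0.
(* The cross term [- 2 f] of the expanded square is moved to the left, so that every integrand is
   nonnegative and additivity in [\bar R] needs no integrability. It appears as [|f|], whose
   integral is known; it equals [f] only almost everywhere. *)
have key : (\int[mu]_(x in posline) (((f x - phi z x) ^+ 2 / phi z x)%:E +
      2%:E * `|f x|%:E) =
    \int[mu]_(x in posline) ((pi / 2 / z)%:E * (f x ^+ 2)%:E +
      (pi / 2 * z)%:E * (x ^+ 2 * f x ^+ 2)%:E + (phi z x)%:E))%E.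
  apply: ge0_ae_eq_integral => //.
  - exact: emeasurable_funD.
  - by apply: emeasurable_funD => //; exact: emeasurable_funD.
  - by move=> x xp; rewrite adde_ge0 ?c'0.
  - by move=> x xp; rewrite adde_ge0 ?ab0 ?p'0.
  move: f0; apply: (@filterS _ _ (ae_filter_ringOfSetsType mu)) => x /= + xp.
  move=> /(_ xp) f0; rewrite -!EFinM -!EFinD; congr (_%:E).
  rewrite ger0_norm// /phi.
  have := lt0r_neq0 (onez2x2_gt0 z x); move: (lt0r_neq0 p0) (lt0r_neq0 z0).
  by move: (f x) pi => y p pn0 zn0 un0; field; rewrite pn0 zn0 exprMn un0.
move: key; rewrite ge0_integralD// ge0_integralZl_EFin//.
rewrite [RHS]ge0_integralD//; last exact: emeasurable_funD.
rewrite ge0_integralD// !ge0_integralZl_EFin//.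
rewrite I1 IA IB integral_phi// mule1 -!EFinM -!EFinD.
(* The identity has a finite right-hand side, which forces the distance integral to be finite; 2 can
   then be cancelled. *)
case: (\int[mu]_(x in posline) _)%E => [r| |]//= [] rE; congr (_%:E).
apply: (addIr 2); rewrite rE; move: (lt0r_neq0 z0) => zn0.
by move: pi => p; field.
Qed.

(** Everything in the theorem about a given [f] is read off here. The value is
    [d = pi * (a * b) - 1], with [a] and [b] the square roots of the moments, and [calJ f] is
    [a * b]. *)
Lemma dist2_calJ f : calC1 f -> exists d : R, [/\ 0 <= d,
  dist2 f = d%:E, calJ f = (pi^-1 + pi^-1 * d)%:E & d = 0 -> calE f].
Proof.
move=> fC; have [A [B [A0 B0 IA IB]]] := calC1_moments fC.
have [mf _ _ _] := fC.
have p0 : 0 < pi :> R := pi_gt0 R.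
pose a := Num.sqrt A; pose b := Num.sqrt B.
have a0 : 0 < a by rewrite sqrtr_gt0.
have b0 : 0 < b by rewrite sqrtr_gt0.
have AE : A = a ^+ 2 by rewrite sqr_sqrtr// ltW.
have BE : B = b ^+ 2 by rewrite sqr_sqrtr// ltW.
pose z0 := a / b; have z00 : 0 < z0 by rewrite divr_gt0.
(* Completing the square: [A / z + z B = 2 a b + (a - z b)^2 / z], whose last term vanishes at
   [z0]. *)
have ID z : 0 < z -> (\int[mu]_(x in posline)
    ((f x - phi z x) ^+ 2 / phi z x)%:E =
    (pi * (a * b) - 1 + pi / 2 * (a - z * b) ^+ 2 / z)%:E)%E.
  move=> z1; rewrite (integral_dist fC IA IB z1) AE BE; congr (_%:E).
  by move: (lt0r_neq0 z1); move: pi => p zn0; field.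
have ID0 : (\int[mu]_(x in posline) ((f x - phi z0 x) ^+ 2 / phi z0 x)%:E =
    (pi * (a * b) - 1)%:E)%E.
  by rewrite ID// /z0 divfK ?gt_eqF// subrr expr0n/= mulr0 mul0r addr0.
have dE : dist2 f = (pi * (a * b) - 1)%:E.
  apply/eqP; rewrite eq_le; apply/andP; split.
    by rewrite -ID0; apply: ereal_inf_lbound; exists z0.
  apply: le_ereal_inf_tmp => _ [z /= z1 <-]; rewrite ID// lee_fin lerDl.
  apply: divr_ge0 (ltW z1); apply: mulr_ge0 (sqr_ge0 _).
  by rewrite divr_ge0// ltW.
exists (pi * (a * b) - 1); split => //.
(* The sharp bound [pi * (a * b) >= 1] comes for free, the left side minus 1 being the integral of a
   nonnegative function. *)
- rewrite -lee_fin -ID0; apply: integral_ge0 => x _.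
  by rewrite lee_fin divr_ge0 ?sqr_ge0// ltW// phi_gt0.
- rewrite /calJ IA IB !poweR_EFin -EFinM !powR12_sqrt ?(ltW A0) ?(ltW B0)//.
  rewrite -/a -/b; congr (_%:E).
  by move: (lt0r_neq0 p0); move: pi => p pn0; field.
(* The infimum is attained at [z0], so [d = 0] kills the integral of [(f - phi z0)^2 / phi z0]
   itself. *)
- move=> d0; exists z0 => //.
  have mphi := measurable_phi z0; have mphiV := measurable_phiV z00.
  have := @ae_eq0_of_integral_sqr_eq0 _ (fun x => f x - phi z0 x) mphiV.
  have -> : (\int[mu]_(x in posline) ((phi z0 x)^-1 * (f x - phi z0 x) ^+ 2)%:E
      = 0)%E.
    by rewrite -[RHS]/(0%:E) -d0 -ID0; apply: eq_integral => x _; rewrite mulrC.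
  move=> H; have {H} := H (measurable_funB mf mphi) _ erefl.
  have V0 x : posline x -> 0 < (phi z0 x)^-1 by rewrite invr_gt0 phi_gt0.
  move=> /(_ V0); apply: filterS => x /= + xp => /(_ xp) /eqP.
  by rewrite subr_eq0 => /eqP.
Qed.

Lemma rho_calC1 f : (@calC1 R `\` calE) f -> rho f = pi^-1%:E.
Proof.
move=> [fC fE]; have [d [d0 dE JE dE0]] := dist2_calJ fC.
(* Outside [calE] the inverse in [rho] is therefore the real one, not the default [+oo]. *)
have dn0 : d != 0 by apply/eqP => /dE0.
rewrite /rho dE JE inver (negPf dn0) -EFinB -EFinM; congr (_%:E).
by move: pi^-1 => p; field.
Qed.

(** * The functions [psi z] are admissible competitors *)

(** Only the weighted square integrability needs work: [psi z x * (1 + x ^+ 2)] is bounded by a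
    constant [C], so the integral is at most [C] times the mass of [psi z]. *)
Lemma calC1_psi z : 0 < z -> calC1 (psi z).
Proof.
move=> z0; have mpsi := measurable_psi z.
have psi0 x : 0 <= psi z x by rewrite ltW// psi_gt0.
have mE : measurable_fun posline (EFin \o psi z) by exact/measurable_EFinP.
split => //; last first.
- under eq_integral do rewrite ger0_norm//.
  exact: integral_psi.
- exact: aeW.
pose C : R := 4 / pi * (z + z^-1).
have C0 : 0 <= C.
  apply: mulr_ge0; first by rewrite divr_ge0 ?pi_ge0.
  by rewrite addr_ge0 ?invr_ge0 ?ltW.
apply: (@le_lt_trans _ _ (\int[mu]_(x in posline) (C%:E * (psi z x)%:E))%E).
  apply: ge0_le_integral => //.
  - by move=> x _; rewrite lee_fin mulr_ge0 ?exprn_ge0// addr_ge0// sqr_ge0.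
  - apply/measurable_EFinP/measurable_funM.
      by apply: measurable_sqr; exact: measurableT_comp.
    by apply: measurable_funD; [exact: measurable_cst|exact: exprn_measurable].
  - exact: measurable_funeM.
  move=> x _; rewrite -EFinM lee_fin ger0_norm// expr2 -mulrA mulrC.
  rewrite ler_wpM2r// /psi /C; have u0 := onez2x2_gt0 z x.
  (* With [t = z^2 x^2] and [v = 1 / z], the left side is [z + v t], and the difference of the two
     sides expands into nonnegative terms. *)
  have zu : z * (1 + x ^+ 2) <= (z + z^-1) * (1 + z ^+ 2 * x ^+ 2) ^+ 2.
    have -> : z * (1 + x ^+ 2) = z + z^-1 * (z ^+ 2 * x ^+ 2).
      by field; rewrite gt_eqF.
    have zV0 : 0 < z^-1 by rewrite invr_gt0.
    have t0 : 0 <= z ^+ 2 * x ^+ 2 by rewrite mulr_ge0 ?sqr_ge0.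
    move: (z ^+ 2 * _) (z^-1) t0 zV0 => t v t0 v0.
    rewrite -subr_ge0.
    have -> : (z + v) * (1 + t) ^+ 2 - (z + v * t) =
        v + 2 * (t * z) + v * t + t ^+ 2 * (z + v) by ring.
    have := mulr_ge0 t0 (ltW z0); have := mulr_ge0 (ltW v0) t0.
    have := mulr_ge0 (sqr_ge0 t) (ltW (addr_gt0 z0 v0)); lra.
  rewrite -[leLHS]mulrA ler_wpM2l ?divr_ge0 ?pi_ge0//.
  rewrite [leLHS]mulrAC.
  by rewrite ler_pdivrMr ?exprn_gt0.
rewrite ge0_integralZl_EFin//; first by rewrite integral_psi// mule1 ltry.
by move=> x _; rewrite lee_fin.
Qed.

(* [psi z] decays like [x ^ -4] and [phi w] only like [x ^ -2], so that they
   differ on a half-line. *)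
Lemma psi_notin_calE z : 0 < z -> ~ calE (psi z).
Proof.
move=> z0 [w w0] E.
(* Put [u = 1 + w^2 x^2] and [s = 1 + z^2 x^2]. Then [psi z x < phi w x] means [2 z u < w s^2]. The
   constant [k] gives [u <= k s], and [x > M] gives [2 z k < w s]; the summand 1 in [M] ensures
   [x > 1], hence [x^2 > M]. *)
pose k := 1 + z^-1 ^+ 2 * w ^+ 2; have k0 : 0 < k by exact: onez2x2_gt0.
pose M := 2 * k * z / w / z ^+ 2 + 1.
have M1 : 1 <= M.
  by rewrite lerDr ltW// divr_gt0 ?exprn_gt0// divr_gt0// !mulr_gt0.
have ltM x : M < x -> psi z x < phi w x.
  move=> Mx; have x1 : 1 < x by exact: le_lt_trans Mx.
  have u0 := onez2x2_gt0 w x; have s0 := onez2x2_gt0 z x.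
  have zV0 : 0 < z^-1 by rewrite invr_gt0.
  have us : 1 + w ^+ 2 * x ^+ 2 <= k * (1 + z ^+ 2 * x ^+ 2).
    have -> : k * (1 + z ^+ 2 * x ^+ 2) =
        1 + w ^+ 2 * x ^+ 2 + (z^-1 * w) ^+ 2 + (z * x) ^+ 2.
      by rewrite /k; field; rewrite gt_eqF.
    by rewrite -addrA lerDl addr_ge0 ?sqr_ge0.
  have ks : 2 * z * k < w * (1 + z ^+ 2 * x ^+ 2).
    have Mx2 : M < x ^+ 2.
      by rewrite (lt_trans Mx)// expr2 ltr_pMr// (lt_trans ltr01).
    have := Mx2; rewrite -(ltr_pM2l (mulr_gt0 w0 (exprn_gt0 2 z0))).
    have -> : w * z ^+ 2 * M = 2 * z * k + w * z ^+ 2.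
      by rewrite /M /k; field; rewrite !gt_eqF.
    have : 0 < w * z ^+ 2 by rewrite mulr_gt0 ?exprn_gt0.
    by rewrite mulrDr mulr1 mulrA; lra.
  pose p : R := 2 / pi; have p0 : 0 < p by rewrite divr_gt0 ?pi_gt0.
  rewrite psiE /phi -/p; move: (1 + w ^+ 2 * _) (1 + z ^+ 2 * _) u0 s0 us ks.
  move=> u s u0 s0 us ks.
  have -> : 2 * (p * (z / s)) / s = p * (2 * z / s ^+ 2).
    by field; rewrite gt_eqF.
  rewrite ltr_pM2l// ltr_pdivrMr ?exprn_gt0// [ltRHS]mulrAC ltr_pdivlMr//.
  rewrite (@le_lt_trans _ _ (2 * z * (k * s)))// ?ler_pM2l ?mulr_gt0//.
  by rewrite mulrA expr2 [ltRHS]mulrA ltr_pM2r.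
(* Almost everywhere equality would make this half-line negligible, although its measure is
   infinite. *)
have : mu.-negligible (`]M, +oo[%classic : set (measurableTypeR R)).
  apply: negligibleS E => x /=; rewrite in_itv/= andbT => Mx /(_ _)E.
  have /E psiE : posline x.
    rewrite /Defs.posline/= in_itv/= andbT (lt_trans _ Mx)//.
    exact: lt_le_trans ltr01 M1.
  by have := ltM _ Mx; rewrite psiE ltxx.
move=> /negligibleP => /(_ (measurable_itv _)) mu0.
have := lebesgue_measure_itv (`]M, +oo[%R : interval R).
rewrite /= ltry; suff -> : lebesgue_measure (`]M, +oo[ : set R) = 0%E by [].
exact: mu0.
Qed.
End stability.

Theorem theorem1p1 (R : realType) :
  [/\ (* the inequality *)
      forall f : R -> R, calC1 f ->
        (pi^-1%:E + pi^-1%:E * dist2 f <= calJ f)%E,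
      (* optimality of the constant *)
      forall c : R,
        (forall f : R -> R, calC1 f ->
           (pi^-1%:E + c%:E * dist2 f <= calJ f)%E) ->
        c <= pi^-1,
      (* the infimum over C_1 \ E *)
      ereal_inf [set rho f | f in @calC1 R `\` calE] = pi^-1%:E,
      (* it is a minimum *)
      [set rho f | f in @calC1 R `\` calE] pi^-1%:E /\
      lbound [set rho f | f in @calC1 R `\` calE] pi^-1%:E
    & (* attained at each psi z *)
      forall z : R, 0 < z ->
        (@calC1 R `\` calE) (psi z) /\ rho (psi z) = pi^-1%:E].
Proof.
have psiC z : 0 < z -> (@calC1 R `\` calE) (psi z).
  by move=> z0; split; [exact: calC1_psi|exact: psi_notin_calE].
(* As [rho] is constant, infimum and minimum reduce to a singleton, nonempty thanks to [psi 1]. *)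
have rhoE : [set rho f | f in @calC1 R `\` calE] = [set pi^-1%:E].
  apply/seteqP; split=> [_ [f fCE <-]|_ ->]; first exact: rho_calC1.
  by exists (psi 1); [exact: psiC|exact/rho_calC1/psiC].
split.
- by move=> f /dist2_calJ[d [_ -> -> _]]; rewrite -EFinM -EFinD.
(* At [psi 1] the inequality with [1 / pi] is an equality and [d > 0], so dividing by [d] bounds
   [c]. *)
- move=> c /(_ (psi 1)); have [fC fE] := psiC 1 ltr01; move=> /(_ fC).
  have [d [d0 -> -> dE]] := dist2_calJ fC.
  rewrite -EFinM -EFinD lee_fin lerD2l ler_pM2r// lt0r d0 andbT.
  by apply/eqP => /dE.
- by rewrite rhoE ereal_inf1.
- by rewrite rhoE; split=> // _ ->.
- by move=> z z0; split; [exact: psiC|exact/rho_calC1/psiC].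
Qed.
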